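(* Let $H$ be a finite group, $p$ a prime, $V$ a simple $\mathbb{Z}_pH$-module, and let $E$ be an extension of $H$ with a $V$-homogeneous module $K$. Let $L\unlhd E$ be the split kernel of $E$. Then $S=E/L$ is a split extension of $H$ with a $V$-homogeneous module, and there exist an integer $n\geq 0$ and cocycles $\gamma_1,\ldots,\gamma_n\in Z^2(H,V)$ such that the cohomology classes in $H^2(H,V)$ induced by $\gamma_1,\ldots,\gamma_n$ are linearly independent (over $\mathbb{Z}_p$) and such that $E$ is the subdirect product of $S$ with $E_{\gamma_1},\ldots,E_{\gamma_n}$, defined by identifying the common factor group $H$.
   Context: Modules are finite-dimensional right modules. A $\mathbb{Z}_pH$-module is $V$-homogeneous if it is a direct sum of finitely many (possibly zero) copies of $V$. An extension of $H$ with a module $K$ is a group $E$ together with an epimorphism $E\to H$ with kernel $K$, such that conjugation in $E$ induces the given $H$-module structure on $K$; it is split if $K$ has a complement in $E$. The split kernel of $E$ is the unique normal subgroup $L\unlhd E$, $L\leq K$, that is minimal with respect to $E/L$ being split over $K/L$ (it exists here, and is the intersection of all $N\unlhd E$ with $N\leq K$ such that $E/N$ is split over $K/N$). For $\gamma\in Z^2(H,V)$ (with $V$ written multiplicatively), $E_\gamma$ is the group with underlying set $H\times V$ and multiplication $(g,v)\cdot(h,w)=(gh,\,v^hw\gamma(g,h))$, with natural epimorphism $\varepsilon_\gamma\colon E_\gamma\to H$, $(h,v)\mapsto h$. $Z^2(H,V)$ and $H^2(H,V)$ are written additively. For groups $E_1,\ldots,E_k$ with epimorphisms $\pi_i\colon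 E_i\to H$, the subdirect product defined by identifying the factor groups $H$ is $\{(a_1,\ldots,a_k)\in E_1\times\cdots\times E_k:\pi_1(a_1)=\cdots=\pi_k(a_k)\}$. ''Is the subdirect product'' means isomorphic to it, compatibly with the projections onto $H$. *)

(* Defs.v *)
From HB Require Import structures.
From mathcomp Require Import all_boot all_order all_algebra all_fingroup.
From mathcomp Require Import all_solvable all_character.

Set Implicit Arguments.
Unset Strict Implicit.
Unset Printing Implicit Defensive.

Import GroupScope GRing.Theory.

(* Conventions.  The finite group H is a finGroupType hT.  A finite-dimensional
   right Z_pH-module is a representation M : mx_representation 'F_p [set: hT] m;
   its elements are the row vectors v : 'rV['F_p]_m and h : hT acts on the right
   by v |-> v *m M h.  Modules are written additively.                         *)

Section Modules.

Variables (hT : finGroupType) (p : nat).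
Variables (d m : nat).
Variable rV : mx_representation 'F_p [set: hT] d.
Variable M : mx_representation 'F_p [set: hT] m.

Definition homogeneous : Prop :=
  exists k : nat, mx_rsim M (muln_grepr (Representation rV) k).

Variables (eT : finGroupType) (E : {group eT}) (pi : {morphism E >-> hT}).

(* iota identifies the module M with the kernel of pi. *)
Definition extension_with : Prop :=
  pi @* E = [set: hT] /\
  exists iota : {morphism [set: 'rV['F_p]_m] >-> eT},
    [/\ 'injm iota, iota @* [set: 'rV['F_p]_m] = 'ker pi
      & forall e v, e \in E -> iota v ^ e = iota (v *m M (pi e))%R].

Definition split_extension_with : Prop :=
  extension_with /\ [splits E, over 'ker pi].

End Modules.

(* Uniqueness of the minimal element is not part of the definition, so a
   statement about all split kernels does not presuppose it.                   *)
Definition split_kernel (hT eT : finGroupType) (E : {group eT})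
    (pi : {morphism E >-> hT}) (L : {group eT}) : bool :=
  [min L | [&& L <| E, L \subset 'ker pi & [splits E / L, over 'ker pi / L]]].

Section Cocycles.

Variables (hT : finGroupType) (p d : nat).
Variable rV : mx_representation 'F_p [set: hT] d.

Implicit Types g h k : hT.

Local Open Scope ring_scope.

(* The identity is the one making the multiplication of cocycle_ext below
   associative; cocycles are not assumed to be normalized.                     *)
Record cocycle2 := Cocycle2 {
  cocycle_fun :> hT -> hT -> 'rV['F_p]_d;
  cocycle2P : forall g h k,
    cocycle_fun g h *m rV k + cocycle_fun (g * h)%g k =
    cocycle_fun h k + cocycle_fun g (h * k)%g
}.

Definition coboundary2 (b : hT -> hT -> 'rV['F_p]_d) : Prop :=
  exists c : hT -> 'rV['F_p]_d,
    forall g h, b g h = c g *m rV h + c h - c (g * h)%g.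

(* Linear independence over 'F_p of the classes in Z^2(H, V) / B^2(H, V). *)
Definition independent_classes (n : nat) (gamma : 'I_n -> cocycle2) : Prop :=
  forall a : 'I_n -> 'F_p,
    coboundary2 (fun g h => \sum_(i < n) a i *: gamma i g h) ->
    forall i, a i = 0.

(* The dependency on gamma selects the group law, which is not that of the
   direct product hT * 'rV_d.                                                  *)
Definition cocycle_ext (gamma : cocycle2) : Type := (hT * 'rV['F_p]_d)%type.

HB.instance Definition _ (gamma : cocycle2) :=
  Finite.copy (cocycle_ext gamma) (hT * 'rV['F_p]_d)%type.

Section ExtensionGroup.

Variable gamma : cocycle2.

Definition ext_mul (x y : cocycle_ext gamma) : cocycle_ext gamma :=
  ((x.1 * y.1)%g, x.2 *m rV y.1 + y.2 + gamma x.1 y.1).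

Definition ext_one : cocycle_ext gamma := (1%g, - gamma 1%g 1%g).

Definition ext_inv (x : cocycle_ext gamma) : cocycle_ext gamma :=
  ((x.1^-1)%g, - ((x.2 + gamma (x.1^-1)%g x.1 + gamma 1%g 1%g) *m rV (x.1^-1)%g)).

Let rVM g h : rV (g * h)%g = rV g *m rV h.
Proof. by rewrite repr_mxM ?inE. Qed.

Let rV1 : rV 1%g = 1%:M.
Proof. exact: repr_mx1. Qed.

Let gamma1l h : gamma 1%g h = gamma 1%g 1%g *m rV h.
Proof.
have := cocycle2P gamma 1%g 1%g h; rewrite !mul1g.
by move/addIr->.
Qed.

Lemma ext_mulA : associative ext_mul.
Proof.
move=> [g u] [h v] [k w]; rewrite /ext_mul /=; congr pair; first exact: mulgA.
rewrite rVM !mulmxDl mulmxA -!addrA; congr (_ + (_ + _)).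
by rewrite -cocycle2P addrCA.
Qed.

Lemma ext_mul1 : left_id ext_one ext_mul.
Proof.
move=> [h v]; rewrite /ext_mul /ext_one /= mul1g; congr pair.
by rewrite (gamma1l h) mulNmx addrC addrA subrr add0r.
Qed.

Lemma ext_mulV : left_inverse ext_one ext_inv ext_mul.
Proof.
move=> [h v]; rewrite /ext_mul /ext_one /ext_inv /= mulVg; congr pair.
rewrite mulNmx -mulmxA -rVM mulVg rV1 mulmx1 -addrA addrC.
by rewrite opprD addrA subrr sub0r.
Qed.

End ExtensionGroup.

HB.instance Definition _ (gamma : cocycle2) :=
  Finite_isGroup.Build (cocycle_ext gamma)
    (@ext_mulA gamma) (@ext_mul1 gamma) (@ext_mulV gamma).

Definition ext_proj (gamma : cocycle2) (x : cocycle_ext gamma) : hT := x.1.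

Lemma ext_projM gamma :
  {in [set: cocycle_ext gamma] &, {morph @ext_proj gamma : x y / (x * y)%g}}.
Proof. by []. Qed.

Canonical ext_proj_morphism gamma := Morphism (@ext_projM gamma).

End Cocycles.

Definition subdirect (hT sT : finGroupType) (S : {group sT})
    (piS : {morphism S >-> hT}) (n : nat) (T : 'I_n -> finGroupType)
    (piT : forall i, {morphism [set: T i] >-> hT}) :
    {set sT * {dffun forall i, T i}} :=
  [set x : sT * {dffun forall i, T i}
     | (x.1 \in S) && [forall i, piT i (x.2 i) == piS x.1]].

(* Main.v *)
Require Import Defs.
From HB Require Import structures.
From mathcomp Require Import all_boot all_order all_algebra all_fingroup.
From mathcomp Require Import all_solvable all_character.

Set Implicit Arguments.
Unset Strict Implicit.
Unset Printing Implicit Defensive.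

Import GroupScope GRing.Theory.

(* Let K = 'ker pi, choose a set-theoretic section of pi and let c be the
   resulting factor set with values in K.  A submodule of a homogeneous module
   has coordinates: homomorphisms to V that identify it with a power of V.
   Taking such coordinates phi_i : K -> V for the submodule L of K, the pushed
   cocycles gamma_i = c phi_i and the induced maps E -> E_(gamma_i) embed E into
   E / L x prod_i E_(gamma_i); injectivity and surjectivity onto the subdirect
   product both say that (phi_i) maps L bijectively onto V^n.  The common kernel
   of the phi_i is a complement of L in K, so K / L is homogeneous as well.
   If sum_i a_i gamma_i were a coboundary with some a_i <> 0, then E would split
   modulo the kernel of phi = sum_i a_i phi_i.  As phi (L) = V, intersecting the
   two supplements of K shows that E also splits modulo the proper subgroup of L
   on which phi vanishes, contradicting the minimality of L.                   *)

(** * Homogeneous modules and coordinates with values in the simple module *)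

Section HomogeneousModules.

Variables (F : fieldType) (gT : finGroupType) (G : {group gT}).
Local Open Scope ring_scope.

Definition intertwines m1 m2 (r1 : mx_representation F G m1)
    (r2 : mx_representation F G m2) (B : 'M[F]_(m1, m2)) : Prop :=
  forall x, x \in G -> r1 x *m B = B *m r2 x.

Lemma intertwines_ker_module m1 m2 (r1 : mx_representation F G m1)
    (r2 : mx_representation F G m2) B :
  intertwines r1 r2 B -> mxmodule r1 (kermx B).
Proof.
move=> homB; apply/mxmoduleP=> x Gx; apply/sub_kermxP.
by rewrite -mulmxA homB // mulmxA mulmx_ker mul0mx.
Qed.

Lemma intertwines_image_module m1 m2 m (r1 : mx_representation F G m1)
    (r2 : mx_representation F G m2) B (W : 'M_(m, m1)) :
  intertwines r1 r2 B -> mxmodule r1 W -> mxmodule r2 (W *m B).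
Proof.
move=> homB /mxmoduleP modW; apply/mxmoduleP=> x Gx.
by rewrite -mulmxA -homB // mulmxA submxMr ?modW.
Qed.

Variables (d : nat) (rV : mx_representation F G d).
Hypothesis irrV : mx_irreducible rV.

(** Homomorphisms to V detect nonzero vectors. This form of homogeneity avoids carrying a
    decomposition along and is what the construction of coordinates consumes. *)
Definition separated m (rM : mx_representation F G m) : Prop :=
  forall v : 'rV_m, v != 0 -> exists2 B, intertwines rM rV B & v *m B != 0.

(** A nonzero vector of a power of V has a nonzero component; the projection to that component
    detects it. *)
Lemma muln_grepr_separated k :
  separated (muln_grepr (Representation rV) k).
Proof.
rewrite /muln_grepr; elim: k => [|k IHk].
  by rewrite big_ord0 => v; rewrite [v]thinmx0 eqxx.
rewrite big_ord_recl => v nzv.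
have [v10 | nzv1] := eqVneq (lsubmx v) 0; last first.
  exists (col_mx 1%:M 0) => [x Gx|].
    rewrite /= mul_block_col mul_col_mx !(mulmx0, mul0mx, mulmx1, mul1mx).
    by rewrite !addr0.
  by rewrite -[v]hsubmxK mul_row_col mulmx1 mulmx0 addr0.
have [|B homB vB] := IHk (rsubmx v).
  by apply: contraNneq nzv => v20; rewrite -[v]hsubmxK v10 v20 row_mx0.
exists (col_mx 0 B) => [x Gx|].
  by rewrite /= mul_block_col mul_col_mx !(mulmx0, mul0mx) !add0r homB.
by rewrite -[v]hsubmxK mul_row_col mulmx0 add0r.
Qed.

Lemma homogeneous_separated m (rM : mx_representation F G m) k :
  mx_rsim rM (muln_grepr (Representation rV) k) -> separated rM.
Proof.
case=> A _ freeA homA v nzv.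
have [|B homB vAB] := @muln_grepr_separated k (v *m A).
  by rewrite mulmx_free_eq0.
exists (A *m B); last by rewrite mulmxA.
by move=> x Gx; rewrite mulmxA homA // -!mulmxA homB.
Qed.

Section Coordinates.

Variables (m : nat) (rM : mx_representation F G m).
Hypothesis sepM : separated rM.

(** Induction on the rank of [W]. A homomorphism [B] that is nonzero on [W] maps [W] onto V by
    simplicity and becomes the first coordinate; the others come from [W :&: kermx B], whose rank is
    smaller. *)
Lemma submodule_coordinates (W : 'M_m) : mxmodule rM W ->
  exists n (phi : 'I_n -> 'M_(m, d)),
    [/\ forall i, intertwines rM rV (phi i),
        forall w : 'rV_m, (w <= W)%MS -> (forall i, w *m phi i = 0) -> w = 0
      & forall t : 'I_n -> 'rV_d,
          exists2 w : 'rV_m, (w <= W)%MS & forall i, w *m phi i = t i].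
Proof.
elim: {W}_.+1 {-2}W (ltnSn (\rank W)) => // r IHr W leWr modW.
have [W0 | /rowV0Pn[v Wv nzv]] := eqVneq W 0.
  exists 0%N, (fun _ => 0); split=> [[] // | w | t].
    by rewrite W0 => /submx0null.
  by exists 0; [apply: sub0mx | case].
have [B homB nzvB] := sepM nzv.
have fullWB : row_full (W *m B).
  (* [mx_irrP] speaks of square matrices, so [W *m B] is replaced by a square matrix with the same
     row space. *)
  suff: row_full <<W *m B>>%MS by rewrite -!sub1mx genmxE.
  case/mx_irrP: irrV => _; apply.
    rewrite (eqmx_module _ (genmxE _)).
    exact: intertwines_image_module homB modW.
  apply: contraNneq nzvB => /eqP.
  rewrite -mxrank_eq0 genmxE mxrank_eq0 => /eqP WB0.
  by have := submxMr B Wv; rewrite WB0 => /submx0null->.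
have modW' : mxmodule rM (W :&: kermx B)%MS.
  by rewrite capmx_module ?(intertwines_ker_module homB).
have [|n [phi [hom_phi inj_phi onto_phi]]] := IHr (W :&: kermx B)%MS _ modW'.
  rewrite -ltnS; apply: leq_trans leWr; rewrite ltnS.
  apply: rank_ltmx; rewrite ltmxE capmxSl sub_capmx submx_refl.
  apply: contraNN nzvB => WkB; apply/eqP/sub_kermxP; exact: submx_trans WkB.
pose psi i := if unlift ord0 i is Some j then phi j else B.
have psi0 : psi ord0 = B by rewrite /psi unlift_none.
have psiS j : psi (lift ord0 j) = phi j by rewrite /psi liftK.
exists n.+1, psi; split=> [i | w Ww w0 | t].
- by rewrite /psi; case: unliftP.
- apply: inj_phi => [|j]; last by rewrite -psiS.
  by rewrite sub_capmx Ww; apply/sub_kermxP; rewrite -psi0.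
have /submxP[w0 def_t0] := submx_full (t ord0) fullWB.
(* [w0 *m W] has the right first coordinate. Adding an element of [W :&: kermx B] keeps it and
   corrects the remaining ones. *)
have [w' W'w' def_w'] := onto_phi (fun j => t (lift ord0 j) - w0 *m W *m phi j).
move: W'w'; rewrite sub_capmx => /andP[Ww' /sub_kermxP w'B].
exists (w0 *m W + w') => [|i]; first by rewrite addmx_sub ?submxMl.
rewrite mulmxDl; case: (unliftP ord0 i) => [j|] ->; last first.
  by rewrite psi0 w'B addr0 -mulmxA.
by rewrite psiS def_w' addrC subrK.
Qed.

End Coordinates.

Lemma homogeneous_of_coordinates e (rN : mx_representation F G e) l
    (psi : 'I_l -> 'M_(e, d)) :
    (forall i, intertwines rN rV (psi i)) ->
    (forall u : 'rV_e, (forall i, u *m psi i = 0) -> u = 0) ->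
    (forall t : 'I_l -> 'rV_d, exists u : 'rV_e, forall i, u *m psi i = t i) ->
  mx_rsim rN (muln_grepr (Representation rV) l).
Proof.
move=> hom_psi inj_psi onto_psi.
(* The degree of the power of V is built up by recursion on [l], so [B], the row of all [psi i], is
   characterized without block indices: its kernel is killed by every [psi i], and each target
   vector is translated into a tuple of coordinates. *)
suff [B homB eqB]: exists2 B, intertwines rN (muln_grepr (Representation rV) l) B
    & (forall u : 'rV_e, u *m B = 0 -> forall i, u *m psi i = 0) /\
      (forall u : 'rV_(rdegree (muln_grepr (Representation rV) l)),
         exists t : 'I_l -> 'rV_d,
           forall w : 'rV_e, (forall i, w *m psi i = t i) -> w *m B = u).
  have freeB : row_free B.
    rewrite -kermx_eq0; apply/eqP/row_matrixP=> i; rewrite row0.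
    by apply/inj_psi/(eqB.1)/sub_kermxP/row_sub.
  have fullB : row_full B.
    rewrite -sub1mx; apply/row_subP=> i.
    have [t wB] := eqB.2 (row i 1%:M); have [w /wB <-] := onto_psi t.
    exact: submxMl.
  by apply: MxReprSim homB => //; rewrite -(eqP freeB) (eqP fullB).
move: psi {inj_psi onto_psi} hom_psi; rewrite /muln_grepr.
elim: l => [|l IHl] psi hom_psi.
  rewrite big_ord0; exists 0 => [x Gx|]; first by rewrite mulmx0 mul0mx.
  split=> [u _ [] // | u]; exists (fun _ => 0) => w _.
  by rewrite [u]thinmx0 mulmx0.
rewrite big_ord_recl /=.
have [B homB [injB ontoB]] :=
  IHl (fun j => psi (lift ord0 j)) (fun j => hom_psi _).
exists (row_mx (psi ord0) B) => [x Gx | ].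
  rewrite /= mul_mx_row mul_row_block !(mulmx0, mul0mx) addr0 add0r.
  by rewrite homB // hom_psi.
split=> [u | u].
  rewrite mul_mx_row -(row_mx0 _ 1 d) => /eq_row_mx[u0 uB] i.
  by case: (unliftP ord0 i) => [j|] -> //; apply: injB.
have [t tB] := ontoB (rsubmx u).
exists (fun i => if unlift ord0 i is Some j then t j else lsubmx u) => w def_w.
rewrite mul_mx_row def_w unlift_none tB ?hsubmxK // => j.
by rewrite def_w liftK.
Qed.

End HomogeneousModules.

(** Complements of [K / L] pull back to supplements [C] of [K] that meet it in [L], so that
    splitting of different quotients can be compared inside [E]. *)
Lemma splits_quotientP (gT : finGroupType) (E K L : {group gT}) :
    L <| E -> L \subset K -> K \subset E ->
  reflect (exists C : {group gT}, [/\ C \subset E, K :&: C = L & K * C = E])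
          [splits E / L, over K / L].
Proof.
move=> nLE sLK sKE; have nLK := normalS sLK sKE nLE.
apply: (iffP splitsP) => [[D /complP[tiKD defE]] | [C [sCE tiKC defE]]].
  exists [group of coset L @*^-1 D]; split=> /=.
  - by rewrite -(quotientGK nLE) morphpreS // -defE mulG_subr.
  - by rewrite -{1}(quotientGK nLK) -morphpreI tiKD /= -kerE ker_coset.
  by rewrite -{1}(quotientGK nLK) -cosetpreM defE quotientGK.
exists [group of C / L]; apply/complP; split=> /=.
  by rewrite -quotientGI ?tiKC ?trivg_quotient.
by rewrite -quotientMl ?defE // (subset_trans sKE) ?normal_norm.
Qed.

(** * Coordinates and factor set of the extension *)

Section Extension.

Variables (hT : finGroupType) (p d : nat).
Variable rV : mx_representation 'F_p [set: hT] d.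
Variables (eT : finGroupType) (E : {group eT}) (pi : {morphism E >-> hT}).
Variables (m : nat) (M : mx_representation 'F_p [set: hT] m).
Hypothesis pi_onto : pi @* E = [set: hT].
Variable iota : {morphism [set: 'rV['F_p]_m] >-> eT}.
Hypothesis injm_iota : 'injm iota.
Hypothesis im_iota : iota @* [set: 'rV['F_p]_m] = 'ker pi.
Hypothesis iotaJ : forall e v, e \in E -> iota v ^ e = iota (v *m M (pi e))%R.

Lemma iotaD u v : iota (u + v)%R = iota u * iota v.
Proof. by rewrite -morphM ?inE. Qed.

Lemma iota0 : iota 0%R = 1. Proof. exact: (morph1 iota). Qed.

Lemma iotaN v : iota (- v)%R = (iota v)^-1.
Proof. by rewrite -morphV ?inE. Qed.

Lemma iota_inj : injective iota.
Proof. by move=> u v; apply: (injmP injm_iota); rewrite inE. Qed.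

Lemma iota_ker v : iota v \in 'ker pi.
Proof. by rewrite -im_iota mem_morphim ?inE. Qed.

Lemma iota_in v : iota v \in E.
Proof. exact: subsetP (subsetIl _ _) _ (iota_ker v). Qed.

Lemma pi_iota v : pi (iota v) = 1.
Proof. exact: mker (iota_ker v). Qed.

Lemma ker_iota e : e \in 'ker pi -> {v | e = iota v}.
Proof.
move=> Ke; exists (invm injm_iota e).
by rewrite invmK // im_iota.
Qed.

Definition sect (h : hT) : eT := repr (E :&: pi @^-1: [set h]).

Lemma sectP h : sect h \in E /\ pi (sect h) = h.
Proof.
have /morphimP[e _ Ee def_h]: h \in pi @* E by rewrite pi_onto inE.
have /mem_repr: e \in E :&: pi @^-1: [set h] by rewrite !inE Ee def_h /=.
by rewrite -/(sect h) !inE => /andP[-> /eqP].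
Qed.

Lemma sect_in h : sect h \in E. Proof. by case: (sectP h). Qed.

Lemma pi_sect h : pi (sect h) = h. Proof. by case: (sectP h). Qed.

(** The kernel part of [e], written to the right of [sect (pi e)] to match the order of factors in
    [cocycle_ext]. Thus [(pi e, fibre e)] serves as a pair of coordinates on [E]. *)
Definition fibre (e : eT) : 'rV['F_p]_m := invm injm_iota ((sect (pi e))^-1 * e).

Lemma fibre_sect h v : fibre (sect h * iota v) = v.
Proof.
rewrite /fibre morphM ?sect_in ?iota_in // pi_iota pi_sect mulg1 mulKg.
by rewrite invmE ?inE.
Qed.

Lemma fibreK e : e \in E -> sect (pi e) * iota (fibre e) = e.
Proof.
move=> Ee; rewrite /fibre invmK ?mulKVg // im_iota; apply/kerP.
  by rewrite groupM ?groupV ?sect_in.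
by rewrite morphM ?morphV ?groupV ?sect_in // pi_sect mulVg.
Qed.

Lemma fibre_iotar e v : e \in E -> fibre (e * iota v) = (fibre e + v)%R.
Proof.
by move=> Ee; rewrite -{1}(fibreK Ee) -mulgA -iotaD fibre_sect.
Qed.

Definition factor_set (g h : hT) : 'rV['F_p]_m := fibre (sect g * sect h).

(** This is the law [ext_mul] with [factor_set] as cocycle: moving [iota (fibre e1)] to the right
    past [sect h] applies [M h]. *)
Lemma fibreM e1 e2 : e1 \in E -> e2 \in E ->
  fibre (e1 * e2) =
    (fibre e1 *m M (pi e2) + fibre e2 + factor_set (pi e1) (pi e2))%R.
Proof.
move=> Ee1 Ee2; set g := pi e1; set h := pi e2.
have ->: e1 * e2 = sect g * sect h * iota (fibre e1 *m M h + fibre e2)%R.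
  rewrite iotaD -{1}(fibreK Ee1) -{1}(fibreK Ee2) -[in M h](pi_sect h).
  by rewrite -iotaJ ?sect_in // -!mulgA mulKVg.
by rewrite fibre_iotar ?groupM ?sect_in // addrC.
Qed.

(** Agrees with [ext_one]; factor sets are treated as unnormalized throughout. *)
Lemma fibre1 : fibre 1 = (- factor_set 1 1)%R.
Proof.
have := fibreM (group1 E) (group1 E); rewrite mulg1 morph1 repr_mx1 mulmx1 -addrA.
by move/eqP; rewrite -subr_eq0 opprD addNKr oppr_eq0 addr_eq0 => /eqP.
Qed.

Lemma fibre_iota v : fibre (iota v) = (v - factor_set 1 1)%R.
Proof. by rewrite -[iota v]mul1g fibre_iotar // fibre1 addrC. Qed.

Lemma fibre_sect0 h : fibre (sect h) = 0%R.
Proof. by rewrite -[sect h]mulg1 -iota0 fibre_sect. Qed.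

(** Both sides are the kernel part of [sect g * sect h * sect k], bracketed in the two possible
    ways. *)
Lemma factor_set_cocycle g h k :
  (factor_set g h *m M k + factor_set (g * h)%g k =
    factor_set h k + factor_set g (h * k)%g)%R.
Proof.
have := congr1 fibre (mulgA (sect g) (sect h) (sect k)).
rewrite !fibreM ?groupM ?sect_in // !morphM ?sect_in // !pi_sect !fibre_sect0.
by rewrite !mul0mx !add0r addr0 => <-.
Qed.

Lemma push_cocycleP (B : 'M['F_p]_(m, d)) (homB : intertwines M rV B) g h k :
  (factor_set g h *m B *m rV k + factor_set (g * h)%g k *m B =
    factor_set h k *m B + factor_set g (h * k)%g *m B)%R.
Proof.
by rewrite -mulmxA -homB ?inE // mulmxA -!mulmxDl factor_set_cocycle.
Qed.

Definition push_cocycle B homB := Cocycle2 (@push_cocycleP B homB).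

(** * The subgroup L as a submodule, and the use of minimality *)

Variable L : {group eT}.

(** Over the prime field every additive subgroup is a subspace, so the row space of this matrix is
    exactly the preimage of [L] under [iota]. *)
Definition coord_mx : 'M['F_p]_m := rowg_mx (iota @*^-1 L).

Lemma coord_mxP v : (v <= coord_mx)%MS = (iota v \in L).
Proof.
by rewrite -mem_rowg rowg_mxK !inE.
Qed.

Hypothesis nLE : L <| E.

Lemma coord_mx_module : mxmodule M coord_mx.
Proof.
apply/mxmoduleP=> h _; apply/row_subP=> i.
rewrite row_mul coord_mxP -(pi_sect h) -iotaJ ?sect_in // memJ_norm.
  by rewrite -coord_mxP row_sub.
exact: subsetP (normal_norm nLE) _ (sect_in h).
Qed.

Hypothesis sLK : L \subset 'ker pi.

(** The kernel [L2] of [B] on [L] is again a candidate for the split kernel: the function [b] cuts a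
    supplement [C1] of K meeting it in [L] down to one meeting it in [L2]. Minimality then gives
    [L2 = L]. *)
Lemma split_kernel_sub_ker B (b : hT -> 'rV['F_p]_d) : split_kernel pi L ->
    intertwines M rV B ->
    (forall g h, factor_set g h *m B = b g *m rV h + b h - b (g * h)%g)%R ->
    (forall t, exists2 w : 'rV_m, (w <= coord_mx)%MS & w *m B = t)%R ->
  forall w : 'rV_m, (w <= coord_mx)%MS -> (w *m B = 0)%R.
Proof.
case/mingroupP=> /and3P[_ _ splitL] minL homB def_b onto_B.
have nKE : 'ker pi <| E by exact: ker_normal.
have [C1 [sC1E tiKC1 defE]] := splits_quotientP nLE sLK (normal_sub nKE) splitL.
pose L2 := [group of iota @* rowg (coord_mx :&: kermx B)%MS].
have L2P v : (iota v \in L2) = (v <= coord_mx)%MS && (v *m B == 0)%R.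
  apply/morphimP/andP=> [[u _ Lu /iota_inj->] | [Lv /eqP vB]].
    by move: Lu; rewrite inE sub_capmx => /andP[-> /sub_kermxP->].
  by exists v; rewrite ?inE // sub_capmx Lv; apply/sub_kermxP.
suffices defL2 : L2 :=: L.
  by move=> w; rewrite coord_mxP -defL2 L2P => /andP[_ /eqP].
have sL2L : L2 \subset L.
  apply/subsetP=> _ /morphimP[v _ Lv ->]; rewrite -coord_mxP.
  by move: Lv; rewrite inE sub_capmx; case/andP.
apply: minL => //.
have sL2K := subset_trans sL2L sLK.
have nL2E : L2 <| E.
  rewrite /normal (subset_trans sL2K (normal_sub nKE)); apply/subsetP=> e Ee.
  rewrite inE; apply/subsetP=> _ /imsetP[y L2y ->].
  have [v def_y] := ker_iota (subsetP sL2K y L2y).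
  move: L2y; rewrite def_y iotaJ // !L2P => /andP[Lv /eqP vB0].
  rewrite -mulmxA homB ?inE // mulmxA vB0 mul0mx eqxx andbT.
  by rewrite (mxmodule_trans coord_mx_module) ?inE.
rewrite nL2E sL2K; apply/(splits_quotientP nL2E sL2K (normal_sub nKE)).
(* The equation defines the second supplement. It is closed under products because [b] trivializes
   the pushed factor set, and on [iota v] it reads [v *m B = 0], since the terms [b 1] cancel. *)
pose C := [set e in C1 | fibre e *m B == - b (pi e)]%R.
have b1 : (factor_set 1 1 *m B = b 1%g)%R.
  by rewrite def_b mulg1 repr_mx1 mulmx1 addrK.
have groupC : group_set C.
  apply/group_setP; split=> [|x y]; rewrite !inE.
    by rewrite group1 fibre1 morph1 mulNmx b1 eqxx.
  case/andP=> C1x /eqP xB /andP[C1y /eqP yB]; rewrite groupM //=.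
  have [Ex Ey] := (subsetP sC1E x C1x, subsetP sC1E y C1y).
  rewrite fibreM // !mulmxDl -mulmxA homB ?inE // mulmxA xB yB def_b morphM //.
  by rewrite mulNmx -opprD addKr.
exists (Group groupC); split=> /=.
- by apply/subsetP=> e; rewrite inE => /andP[/(subsetP sC1E)].
- apply/setP=> e; apply/setIP/idP=> [[Ke] | L2e].
    have [v def_e] := ker_iota Ke; rewrite inE => /andP[C1e].
    rewrite def_e fibre_iota mulmxBl b1 pi_iota subr_eq addrC subrr L2P => ->.
    by rewrite andbT coord_mxP -def_e -tiKC1 inE Ke.
  have Le := subsetP sL2L e L2e; have Ke := subsetP sLK e Le.
  split=> //; have [v def_e] := ker_iota Ke; rewrite inE.
  have ->: e \in C1 by move: Le; rewrite -{1}tiKC1 inE => /andP[].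
  move: L2e; rewrite def_e L2P => /andP[_ /eqP vB0].
  by rewrite fibre_iota mulmxBl b1 pi_iota vB0 sub0r eqxx.
apply/eqP; rewrite eqEsubset mul_subG ?(normal_sub nKE) //=; last first.
  by apply/subsetP=> e; rewrite inE => /andP[/(subsetP sC1E)].
apply/subsetP=> e; rewrite -{1}defE => /mulsgP[k c Kk C1c ->].
have Ec := subsetP sC1E c C1c.
(* The factor [c] is moved into [C] by an element of [L], which stays inside [C1]; it exists because
   [B] maps [L] onto V. *)
have [w Lw wB] := onto_B (- b (pi c) - fibre c *m B)%R.
apply/mulsgP; exists (k * (iota w)^-1 ^ c^-1) (c * iota w) => [||].
- rewrite groupM // memJ_norm ?groupV ?iota_ker //.
  exact: subsetP (normal_norm nKE) _ Ec.
- have C1w : iota w \in C1.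
    by move: Lw; rewrite coord_mxP -tiKC1 => /setIP[].
  rewrite inE groupM //= fibre_iotar // morphM ?iota_in // pi_iota mulg1.
  by rewrite mulmxDl wB addrC subrK.
by rewrite conjgE invgK -!mulgA mulKg mulVg mulg1.
Qed.

(** * The quotient by L as an extension with a homogeneous module *)

Lemma quotient_extension n (phi : 'I_n -> 'M['F_p]_(m, d))
    (piS : {morphism (E / L)%G >-> hT}) :
    mx_irreducible rV -> separated rV M ->
    (forall i, intertwines M rV (phi i)) ->
    (forall w : 'rV_m,
       (w <= coord_mx)%MS -> (forall i, w *m phi i = 0) -> w = 0)%R ->
    (forall t : 'I_n -> 'rV_d,
       exists2 w : 'rV_m, (w <= coord_mx)%MS & forall i, w *m phi i = t i)%R ->
    (forall e, e \in E -> piS (coset L e) = pi e) ->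
  exists l (N : mx_representation 'F_p [set: hT] l),
    homogeneous rV N /\ extension_with N piS.
Proof.
move=> irrV sepM hom_phi inj_phi onto_phi piSE.
(* Each [v] shares its coordinates with some [w] of [L], and then [v - w] lies in [U]. As [U] meets
   [L] trivially, it is a model of K / L. *)
pose U := (\bigcap_i kermx (phi i))%MS.
have UP (v : 'rV_m) : reflect (forall i, v *m phi i = 0)%R (v <= U)%MS.
  by apply: (iffP sub_bigcapmxP) => vU i *; apply/sub_kermxP/vU.
have modU : mxmodule M U.
  by apply: bigcapmx_module => i _; apply: intertwines_ker_module (hom_phi i).
have [l [psi [hom_psi inj_psi onto_psi]]] := submodule_coordinates irrV sepM modU.
exists (\rank U), (submod_repr modU); split.
  exists l.
  (* [val_submod 1%:M] is the inclusion of [U], so these are the coordinates of [U] read on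
     [submod_repr modU]. *)
  apply: homogeneous_of_coordinates (fun i => val_submod 1%:M *m psi i)%R _ _ _.
  - move=> i x Gx; rewrite /= mulmxA -val_submodE -[submod_mx _ _]mul1mx.
    by rewrite val_submodJ // -!mulmxA hom_psi.
  - move=> u u0; apply/eqP; rewrite -val_submod_eq0; apply/eqP/inj_psi=> [|i].
      exact: val_submodP.
    by rewrite val_submodE -mulmxA.
  - move=> t; have [w Uw def_w] := onto_psi t; exists (in_submod U w) => i.
    by rewrite mulmxA -val_submodE in_submodK.
have nLiota v : iota v \in 'N(L).
  exact: subsetP (normal_norm nLE) _ (iota_in v).
have imS h : exists2 x, x \in E / L & piS x = h.
  by exists (coset L (sect h)); rewrite ?mem_quotient ?piSE ?sect_in ?pi_sect.
split.
  apply/setP=> h; rewrite inE; have [x Sx <-] := imS h.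
  exact: mem_morphim.
pose j (u : 'rV['F_p]_(\rank U)) := coset L (iota (val_submod u)).
have jM : {in [set: 'rV['F_p]_(\rank U)] &, {morph j : u v / u * v}}.
  by move=> u v _ _; rewrite /j -morphM //= -iotaD -linearD.
have jE w : (w <= U)%MS -> j (in_submod U w) = coset L (iota w).
  by move=> Uw; rewrite /j in_submodK.
exists (Morphism jM); split=> /=.
- apply/subsetP=> u /morphpreP[_ /set1P /= /coset_idr Lu]; apply/set1P/eqP.
  rewrite -val_submod_eq0; apply/eqP/inj_phi; first by rewrite coord_mxP Lu.
  by apply/UP/val_submodP.
- apply/setP=> x; apply/morphimP/morphpreP=> [[u _ _ ->] | [Sx /set1P piSx]].
    by rewrite inE /= piSE ?iota_in ?pi_iota ?mem_quotient ?iota_in.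
  have /morphimP[e nLe Ee def_x] := Sx.
  have [v def_e]: {v | e = iota v}.
    by apply/ker_iota/kerP=> //; rewrite -piSE // -piSx def_x.
  have [w Lw wE] := onto_phi (fun i => v *m phi i)%R.
  exists (in_submod U (v - w)%R); rewrite ?inE //.
  rewrite -[RHS]/(j _) jE; last by apply/UP=> i; rewrite mulmxBl wE subrr.
  rewrite iotaD iotaN morphM ?groupV // morphV // def_x def_e.
  by rewrite [coset_morphism L (iota w)]coset_id ?invg1 ?mulg1 // -coord_mxP.
move=> x u /morphimP[e nLe Ee ->]; rewrite /= piSE // /j -morphJ ?nLiota //.
by rewrite iotaJ // val_submodJ ?inE.
Qed.

(** * The isomorphism with the subdirect product *)

Definition embed n (gamma : 'I_n -> cocycle2 rV)
    (phi : 'I_n -> 'M['F_p]_(m, d)) (e : eT) :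
    coset_of L * {dffun forall i, cocycle_ext (gamma i)} :=
  (coset L e, [ffun i => (pi e, fibre e *m phi i)%R : cocycle_ext (gamma i)]).

(** In the coordinates [(pi e, fibre e)] each map to [cocycle_ext (gamma i)] just applies [phi i] to
    the second entry, which turns [fibreM] into [ext_mul]. *)
Lemma embedM n (gamma : 'I_n -> cocycle2 rV) phi :
    (forall i, intertwines M rV (phi i)) ->
    (forall i g h, gamma i g h = factor_set g h *m phi i)%R ->
  {in E &, {morph (embed gamma phi) : x y / x * y}}.
Proof.
move=> hom_phi def_gamma x y Ex Ey; have nLE' := subsetP (normal_norm nLE).
congr pair; first by rewrite morphM ?nLE'.
apply/ffunP=> i; rewrite dffunM !ffunE; congr pair; first exact: morphM.
by rewrite fibreM // !mulmxDl -def_gamma /= -!mulmxA hom_phi ?inE //.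
Qed.

Lemma embed_isom n (gamma : 'I_n -> cocycle2 rV) phi
    (homf : {in E &, {morph (embed gamma phi) : x y / x * y}})
    (piS : {morphism (E / L)%G >-> hT}) :
    (forall w : 'rV_m,
       (w <= coord_mx)%MS -> (forall i, w *m phi i = 0) -> w = 0)%R ->
    (forall t : 'I_n -> 'rV_d,
       exists2 w : 'rV_m, (w <= coord_mx)%MS & forall i, w *m phi i = t i)%R ->
    (forall e, e \in E -> piS (coset L e) = pi e) ->
  isom E (subdirect piS (fun i => ext_proj_morphism (gamma i))) (Morphism homf).
Proof.
move=> inj_phi onto_phi piSE; have nLE' := subsetP (normal_norm nLE).
apply: sub_isom => //; last first.
  apply/injmP=> x y Ex Ey [eqL /ffunP eq_phi].
  (* Elements with the same image differ by an element of [L], all of whose coordinates vanish. *)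
  have Lxy : x^-1 * y \in L.
    apply: coset_idr; first by rewrite groupM ?groupV ?nLE'.
    by rewrite morphM ?morphV ?groupV ?nLE' //= eqL mulVg.
  have [v def_xy] := ker_iota (subsetP sLK _ Lxy).
  suffices v0: v = 0%R by rewrite -(mulKVg x y) def_xy v0 iota0 mulg1.
  apply: inj_phi => [|i]; first by rewrite coord_mxP -def_xy.
  have := eq_phi i; rewrite !ffunE -{2}(mulKVg x y) def_xy fibre_iotar // => -[_].
  by rewrite mulmxDl -{1}[(_ *m _)%R]addr0 => /addrI.
apply/setP=> [[x t]]; rewrite inE /=.
apply/morphimP/andP=> [[e _ Ee [-> ->]] | [Sx /forallP eqt]].
  rewrite mem_quotient //; split=> //; apply/forallP=> i.
  by rewrite ffunE /ext_proj /= piSE.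
have /morphimP[e nLe Ee def_x] := Sx.
(* A lift [e] of [x] is adjusted by an element of [L]: its coset is unchanged, while its coordinates
   become those prescribed by [t]. *)
have [w Lw wE] := onto_phi (fun i => (t i).2 - fibre e *m phi i)%R.
exists (e * iota w); rewrite ?groupM ?iota_in //.
have Liw : iota w \in L by rewrite -coord_mxP.
congr pair; first by rewrite coset_kerr.
apply/ffunP=> i; rewrite ffunE morphM ?iota_in // pi_iota mulg1 fibre_iotar //.
rewrite mulmxDl wE addrC subrK; have /eqP := eqt i; rewrite /= def_x piSE //.
by rewrite /ext_proj; case: (t i) => g v /= ->.
Qed.

(** * Linear independence of the classes *)

Lemma push_cocycles_independent n (phi : 'I_n -> 'M['F_p]_(m, d))
    (hom_phi : forall i, intertwines M rV (phi i)) :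
    0 < d -> split_kernel pi L ->
    (forall t : 'I_n -> 'rV_d,
       exists2 w : 'rV_m, (w <= coord_mx)%MS & forall i, w *m phi i = t i)%R ->
  independent_classes (fun i => push_cocycle (hom_phi i)).
Proof.
move=> d_gt0 kerL onto_phi a [b def_b] j; apply/eqP/negPn/negP=> nz_aj.
pose B := (\sum_i a i *: phi i)%R.
have vB k (A : 'M_(k, m)) : (A *m B = \sum_i a i *: (A *m phi i))%R.
  by rewrite mulmx_sumr; apply: eq_bigr => i _; rewrite scalemxAr.
have homB : intertwines M rV B.
  move=> x Gx; rewrite vB mulmx_suml; apply: eq_bigr => i _.
  by rewrite hom_phi // scalemxAl.
have onto_B (t : 'rV_d) : exists2 w : 'rV_m, (w <= coord_mx)%MS & (w *m B = t)%R.
  (* Only the coordinate [j] is made nonzero; dividing by [a j] yields the value [t]. *)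
  have [w Lw wE] := onto_phi (fun i => if i == j then (a j)^-1 *: t else 0)%R.
  exists w => //; rewrite vB (bigD1 j) //= wE eqxx scalerA divff // scale1r.
  by rewrite big1 ?addr0 // => i /negPf ne_ij; rewrite wE ne_ij scaler0.
have fsB g h : (factor_set g h *m B = b g *m rV h + b h - b (g * h)%g)%R.
  by rewrite vB def_b.
(* The constant vector 1 is nonzero because [d > 0], whereas minimality of [L] forces [B] to vanish
   on [L]. *)
have [w Lw wE] := onto_B (const_mx 1%R).
have := split_kernel_sub_ker kerL homB fsB onto_B Lw.
rewrite wE => /rowP/(_ (Ordinal d_gt0))/eqP.
by rewrite !mxE oner_eq0.
Qed.

End Extension.

(** * Assembly of the decomposition *)

Theorem theorem4p5 (hT : finGroupType) (p : nat) (p_prime : prime p)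
    (d : nat) (rV : mx_representation 'F_p [set: hT] d)
    (simpleV : mx_irreducible rV)
    (eT : finGroupType) (E : {group eT}) (pi : {morphism E >-> hT})
    (m : nat) (M : mx_representation 'F_p [set: hT] m)
    (homM : homogeneous rV M) (extE : extension_with M pi)
    (L : {group eT}) (kerL : split_kernel pi L) :
  exists piS : {morphism (E / L)%G >-> hT},
    [/\ forall e, e \in E -> piS (coset L e) = pi e,
        exists (l : nat) (N : mx_representation 'F_p [set: hT] l),
          homogeneous rV N /\ split_extension_with N piS
      & exists (n : nat) (gamma : 'I_n -> cocycle2 rV),
          independent_classes gamma /\
          exists f : {morphism E >->
              coset_of L * {dffun forall i, cocycle_ext (gamma i)}},
            isom E
              (subdirect piS (fun i => ext_proj_morphism (gamma i))) f /\
            forall e, e \in E -> piS (f e).1 = pi e].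
Proof.
have [pi_onto [iota [injm_iota im_iota iotaJ]]] := extE.
have [/and3P[nLE sLK splitL] _] := mingroupP kerL.
have [k simM] := homM; have sepM := homogeneous_separated simM.
have modL := coord_mx_module pi_onto iotaJ nLE.
have [n [phi [hom_phi inj_phi onto_phi]]] :=
  submodule_coordinates simpleV sepM modL.
have sker : 'ker (coset L) \subset 'ker pi by rewrite ker_coset.
pose piS := factm_morphism sker (normal_norm nLE).
have piSE e : e \in E -> piS (coset L e) = pi e by move=> Ee; rewrite [LHS]factmE.
exists piS; split=> //.
  have [l [N [homN extN]]] := quotient_extension pi_onto injm_iota im_iota iotaJ
    nLE simpleV sepM hom_phi inj_phi onto_phi piSE.
  exists l, N; split=> //; split=> //.
  (* The kernel of [piS] is ['ker pi / L], over which [E / L] splits by the choice of [L]. *)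
  by rewrite ker_factm.
pose gamma i := push_cocycle pi_onto injm_iota im_iota iotaJ (hom_phi i).
exists n, gamma; split.
  have d_gt0 : 0 < d by case/mx_irrP: simpleV.
  by apply: push_cocycles_independent kerL onto_phi.
have homf : {in E &, {morph (embed pi injm_iota L gamma phi) : x y / x * y}}.
  by apply: embedM => //; apply: iotaJ.
exists (Morphism homf); split; first exact: embed_isom.
by move=> e Ee; apply: piSE.
Qed.
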